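(* Let $\mathcal{H}=\mathcal{H}(\Omega)$ be a functional (reproducing kernel) Hilbert space on a nonempty set $\Omega$, let $t\in[0,1]$ and let $A,B\in\mathcal{B}(\mathcal{H})$ satisfy $|A|B=B^*|A|$. Then $$\|AB\|_{t-ber}\le r(B)\sqrt{\big\|t|A|+(1-t)|A^*|\big\|_{ber}\,\big\|t|A^*|+(1-t)|A|\big\|_{ber}}.$$ In particular, for $t=1/2$, $$\|AB\|_{\frac12-ber}\le\frac12\,r(B)\,\big\||A|+|A^*|\big\|_{ber}.$$
   Context: A functional (reproducing kernel) Hilbert space $\mathcal{H}=\mathcal{H}(\Omega)$ is a Hilbert space of complex-valued functions on a nonempty set $\Omega$ such that for every $\lambda\in\Omega$ the evaluation $f\mapsto f(\lambda)$ is a continuous linear functional; $k_\lambda\in\mathcal{H}$ is the unique element with $f(\lambda)=\langle f,k_\lambda\rangle$ for all $f\in\mathcal{H}$. It is assumed that $k_\lambda\neq0$ for all $\lambda\in\Omega$, and $\hat{k}_\lambda=k_\lambda/\|k_\lambda\|$ is the normalized reproducing kernel. $\mathcal{B}(\mathcal{H})$ is the algebra of bounded linear operators on $\mathcal{H}$; $|A|=(A^*A)^{1/2}$; $r(B)$ is the spectral radius of $B$. For $A\in\mathcal{B}(\mathcal{H})$ and $t\in[0,1]$, $$\|A\|_{t-ber}=\sup_{\lambda,\mu\in\Omega}\left\{t|\langle A\hat{k}_\lambda,\hat{k}_\mu\rangle|+(1-t)|\langle A^*\hat{k}_\lambda,\hat{k}_\mu\rangle|\right\},\qquad \|A\|_{ber}=\sup_{\lambda,\mu\in\Omega}|\langle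 A\hat{k}_\lambda,\hat{k}_\mu\rangle|.$$ *)

(* Defs.v *)
From HB Require Import structures.
From mathcomp Require Import all_boot all_order all_algebra.
From mathcomp Require Import complex.
From mathcomp Require Import all_classical all_reals.
From mathcomp Require Import topology normedtype.

Set Implicit Arguments.
Unset Strict Implicit.
Unset Printing Implicit Defensive.

Import Order.TTheory GRing.Theory Num.Theory Num.Def.
Import numFieldNormedType.Exports.

Local Open Scope classical_set_scope.
Local Open Scope complex_scope.
Local Open Scope ring_scope.

(* The elements of H are functions on Omega through the injective linear map
   [fun_of].  The form [dot] is linear in its first argument and antilinear in
   its second one. *)
Record functional_hilbert (R : realType) (Omega : Type) := FunctionalHilbert {
  hilbert_sort :> completeNormedModType R[i];
  dot : {dot hilbert_sort for conjC};
  dot_normE : forall f : hilbert_sort, `|f| ^+ 2 = dot f f;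
  fun_of : {linear hilbert_sort -> (Omega -> R[i])};
  fun_of_inj : injective fun_of;
  fun_of_continuous : forall l : Omega,
    continuous (fun f : hilbert_sort => fun_of f l : R[i]^o)
}.

Section Operators.
Context (R : realType) (Omega : Type) (H : functional_hilbert R Omega).
Implicit Types A B P S T : H -> H.

Definition kernel (l : Omega) : H :=
  xget 0 [set k : H | forall f : H, fun_of H f l = dot H f k].

Definition nkernel (l : Omega) : H := `|kernel l|^-1 *: kernel l.

Definition bounded_op T : Prop := linear T /\ continuous T.

Definition positive_op T : Prop := forall f : H, 0 <= dot H (T f) f.

(* In the next two definitions the required operator exists and is unique as
   soon as A is bounded, resp. T is bounded and positive; the default value 0
   is not used then. *)
Definition adjoint A : H -> H :=
  xget (cst 0) [set S : H -> H |
    bounded_op S /\ forall f g : H, dot H (A f) g = dot H f (S g)].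

Definition sqrt_op T : H -> H :=
  xget (cst 0) [set P : H -> H |
    [/\ bounded_op P, positive_op P & P \o P = T]].

Definition abs_op A : H -> H := sqrt_op (adjoint A \o A).

Definition invertible_op T : Prop :=
  exists S, [/\ bounded_op S, S \o T = id & T \o S = id].

Definition spectrum B : set R[i] :=
  [set z | ~ invertible_op (fun f => B f - z *: f)].

(* [Re `|z|] is the modulus of z, as an element of R rather than of R[i]. *)
Definition spectral_radius B : R :=
  sup [set complex.Re `|z| | z in spectrum B].

Definition tber (t : R) A : R :=
  sup [set t * complex.Re `|dot H (A (nkernel p.1)) (nkernel p.2)|
           + (1 - t) * complex.Re `|dot H (adjoint A (nkernel p.1)) (nkernel p.2)|
      | p in [set: Omega * Omega]].

Definition ber A : R :=
  sup [set complex.Re `|dot H (A (nkernel p.1)) (nkernel p.2)|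
      | p in [set: Omega * Omega]].

Definition add_op A B : H -> H := fun f => A f + B f.

Definition scale_op (a : R) A : H -> H := fun f => a%:C *: A f.

End Operators.

(* Main.v *)
Require Import Defs.
From HB Require Import structures.
From mathcomp Require Import all_boot all_order all_algebra.
From mathcomp Require Import complex.
From mathcomp Require Import all_classical all_reals.
From mathcomp Require Import topology normedtype.
From mathcomp Require Import ring lra.

Set Implicit Arguments.
Unset Strict Implicit.
Unset Printing Implicit Defensive.

Import Order.TTheory GRing.Theory Num.Theory Num.Def.
Import numFieldNormedType.Exports.

Local Open Scope classical_set_scope.
Local Open Scope ring_scope.

(** Put P = |A|, Q = |A^*| and r = r(B). Everything follows from the pointwise
    estimate

      |<A B x, y>|^2 <= r^2 <P x, x> <Q y, y>                              (1)

    by applying it to the normalized kernels x, y and to the same vectors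
    exchanged (for the adjoint of A B), by the Cauchy-Schwarz inequality for the
    weights t and 1 - t, and by <T k, k> <= ber T for a normalized kernel k.

    Estimate (1) is the composition of two inequalities. The mixed Schwarz
    inequality |<A z, y>|^2 <= <P z, z> <Q y, y>, for z = B x, needs no polar
    decomposition: since A P = Q A, for z = P w it is the Cauchy-Schwarz
    inequality of the positive form <Q _, _>, and the space is the sum of the
    closure of the range of P and of ker P = ker A.

    The second inequality is <P B x, B x> <= r^2 <P x, x>. The hypothesis
    P B = B^* P says that B is symmetric for the semi-inner product <P _, _>.
    Reid's inequality shows that a bounded S which is symmetric in this sense,
    with norm at most c, satisfies <P S x, S x> <= c^2 <P x, x>. Let s be the
    best constant in <P B x, B x> <= s <P x, x>. If s > r^2, then neither square
    root of s belongs to the spectrum of B, so B^2 - s has a bounded inverse,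
    again symmetric, of norm at most some c. Writing q x = <P x, x>, Reid's
    inequality for this inverse gives

      q x <= c^2 q (B^2 x - s x) <= c^2 s (s q x - q (B x)),

    that is, q (B x) <= (s - 1 / (c^2 s)) q x, against the choice of s. Hence no
    spectral radius formula is needed: it suffices that the spectrum be bounded.

    The Hilbert space theory behind this is built from the completeness of the
    norm: orthogonal projection, Riesz representation, existence of adjoints,
    and existence and uniqueness of the square root of A^* A, the limit in norm
    of an iteration that any operator intertwining A^* A and A A^* respects;
    this last fact gives A |A| = |A^*| A. *)

(** * Real-valued norms and completeness *)

Section RealNorm.
Context (R : realType).
Local Notation C := R[i].

(** The norm, which takes its values in R[i], as a real number. *)
Definition nm (V : normedZmodType C) (x : V) : R := complex.Re `|x|.

Lemma normE (V : normedZmodType C) (x : V) : `|x| = (nm x)%:C%C.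
Proof.
have /ger0_Im h := normr_ge0 x.
by move: h; rewrite /nm; case: `|x| => a b /= ->.
Qed.

Lemma nm_ge0 (V : normedZmodType C) (x : V) : 0 <= nm x.
Proof. by have := normr_ge0 x; rewrite normE ler0c. Qed.

Lemma nmD (V : normedZmodType C) (x y : V) : nm (x + y) <= nm x + nm y.
Proof. by have := ler_normD x y; rewrite !normE -rmorphD lecR. Qed.

Lemma nmN (V : normedZmodType C) (x : V) : nm (- x) = nm x.
Proof. by rewrite /nm normrN. Qed.

Lemma nmB (V : normedZmodType C) (x y : V) : nm (x - y) = nm (y - x).
Proof. by rewrite /nm distrC. Qed.

Lemma nm0 (V : normedZmodType C) : nm (0 : V) = 0.
Proof. by rewrite /nm normr0. Qed.

Lemma nm0_eq0 (V : normedZmodType C) (x : V) : nm x <= 0 -> x = 0.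
Proof.
move=> h; apply/normr0_eq0; rewrite normE.
by have/eqP -> : nm x == 0; rewrite ?eq_le ?h ?nm_ge0.
Qed.

Lemma nmM (z w : C) : nm (z * w) = nm z * nm w.
Proof. by rewrite {1}/nm normrM !normE -rmorphM. Qed.

Lemma nmZ (V : normedModType C) (z : C) (x : V) : nm (z *: x) = nm z * nm x.
Proof. by rewrite {1}/nm normrZ !normE -rmorphM. Qed.

Lemma nmR (a : R) : nm (a%:C%C) = `|a|.
Proof. by rewrite /nm normc_def /= expr0n addr0 sqrtr_sqr. Qed.

Lemma nm_half : nm (2^-1 : C) = 2^-1.
Proof.
have -> : (2^-1 : C) = (2^-1 : R)%:C%C by rewrite fmorphV rmorph_nat.
by rewrite nmR ger0_norm // invr_ge0.
Qed.

Lemma nm_sqr (z : C) : nm z ^+ 2 = complex.Re z ^+ 2 + complex.Im z ^+ 2.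
Proof. by rewrite /nm normc_def /= sqr_sqrtr ?addr_ge0 ?sqr_ge0. Qed.

Lemma nm_conj (z : C) : nm (conjC z) = nm z.
Proof. by rewrite /nm norm_conjC. Qed.

Lemma Re_le_nm (z : C) : complex.Re z <= nm z.
Proof.
have h := nm_ge0 z; have := nm_sqr z; have := sqr_ge0 (complex.Im z).
by move=> h1 h2; rewrite leNgt; apply/negP => h3; nra.
Qed.

Lemma conjC_conjc (z : C) : conjC z = conjc z. Proof. by []. Qed.

(** A quadratic inequality in one real parameter is behind both the
    Cauchy-Schwarz inequality and the orthogonality of nearest points. *)
Lemma quadratic_ineq (a w c : R) : 0 <= w -> 0 <= c ->
  (forall s : R, 0 <= a - 2 * s * w + s ^+ 2 * w * c) -> w <= a * c.
Proof.
move=> w0 c0 h; have a0 : 0 <= a by have := h 0; lra.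
have [c_eq0|cN0] := eqVneq c 0.
  rewrite c_eq0 mulr0 leNgt; apply/negP => w_gt0.
  have := h ((a + 1) / (2 * w)); rewrite c_eq0.
  by rewrite (_ : _ + _ = -1) ?ler0N1 //; field; rewrite gt_eqF.
have c_gt0 : 0 < c by rewrite lt_def cN0.
have := h c^-1; rewrite (_ : _ + _ = a - w / c); last by field.
by rewrite subr_ge0 ler_pdivrMr.
Qed.

(** Completeness, in terms of an explicit modulus of convergence. *)
Lemma modulus_cvg (V : completeNormedModType C) (u : nat -> V) (b : nat -> R) :
  (forall n m, (n <= m)%N -> nm (u m - u n) <= b n) ->
  (forall e : R, 0 < e -> exists n, b n < e) ->
  exists l, forall n, nm (l - u n) <= b n.
Proof.
move=> ub b0.
have cu : cauchy (u @ \oo).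
  apply: cauchy_exP => e e0.
  have [e_real] : e = (complex.Re e)%:C%C.
    by move: e0; rewrite ltcE; case: (e) => a c /= /andP[/eqP -> _].
  have [|n bn] := b0 (complex.Re e); first by move: e0; rewrite ltcE => /andP[].
  exists (u n); exists n => // m /= nlem.
  rewrite -ball_normE /= normE {1}e_real ltcR nmB.
  exact: le_lt_trans (ub _ _ nlem) bn.
have /cvg_ex[l ul] : cvg (u @ \oo) by exact: cauchy_cvg.
exists l => n; apply/ler_addgt0Pl => e e0.
have /cvgrPdist_lt/(_ (e%:C%C)) := ul.
rewrite ltcR => /(_ e0)[k _ hk].
have := hk (maxn k n) (leq_maxl _ _); rewrite /= normE ltcR => h.
have := ub n (maxn k n) (leq_maxr _ _) => h2.
rewrite (_ : l - u n = (l - u (maxn k n)) + (u (maxn k n) - u n)); last first.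
  by rewrite addrA subrK.
apply: le_trans (nmD _ _) _; lra.
Qed.

Lemma invn_small (e : R) : 0 < e -> exists n : nat, n.+1%:R^-1 < e.
Proof.
move=> e0; exists (Num.bound e^-1).
rewrite invf_plt ?posrE ?ltr0Sn //.
have := archi_boundP (ltW (_ : 0 < e^-1)); rewrite invr_gt0 => /(_ e0) h.
by apply: lt_trans h _; rewrite ltr_nat.
Qed.

End RealNorm.

(** * Linear maps, inner products and the Cauchy-Schwarz inequality *)

Section LinearMaps.
Context (K : pzRingType) (U V : lmodType K) (T : U -> V).
Hypothesis T_lin : linear T.

Lemma lin0 : T 0 = 0.
Proof. by have := T_lin (-1) 0 0; rewrite scaler0 addr0 scaleN1r addNr. Qed.

Lemma linD x y : T (x + y) = T x + T y.
Proof. by have := T_lin 1 x y; rewrite !scale1r. Qed.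

Lemma linZ a x : T (a *: x) = a *: T x.
Proof. by have := T_lin a x 0; rewrite lin0 !addr0. Qed.

Lemma linN x : T (- x) = - T x.
Proof. by rewrite -scaleN1r linZ scaleN1r. Qed.

Lemma linB x y : T (x - y) = T x - T y.
Proof. by rewrite linD linN. Qed.

End LinearMaps.

Section InnerProduct.
Context (R : realType) (Omega : Type) (H : functional_hilbert R Omega).
Local Notation C := R[i].
Local Notation "''[' x , y ]" := (dot H x y).
Local Notation Re := (@complex.Re R).
Local Notation Im := (@complex.Im R).
Implicit Types (x y z : H) (a : C) (P S T : H -> H).

Lemma ReD (z w : C) : Re (z + w) = Re z + Re w.
Proof. by case: z w => [? ?] [? ?]. Qed.

Lemma ImD (z w : C) : Im (z + w) = Im z + Im w.
Proof. by case: z w => [? ?] [? ?]. Qed.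

Lemma ReN (z : C) : Re (- z) = - Re z.
Proof. by case: z. Qed.

Lemma ImN (z : C) : Im (- z) = - Im z.
Proof. by case: z. Qed.

Lemma dotC x y : '[y, x] = conjC '[x, y].
Proof. by rewrite hermC /= mul1r. Qed.

Lemma dotDl x y z : '[x + y, z] = '[x, z] + '[y, z].
Proof. exact: linearDl. Qed.

Lemma dotZl a x z : '[a *: x, z] = a * '[x, z].
Proof. exact: linearZl_LR. Qed.

Lemma dotDr x y z : '[z, x + y] = '[z, x] + '[z, y].
Proof. by rewrite dotC dotDl rmorphD /= -!dotC. Qed.

Lemma dotZr a x z : '[z, a *: x] = conjC a * '[z, x].
Proof. by rewrite dotC dotZl rmorphM /= -!dotC. Qed.

Lemma dot0l z : '[0, z] = 0.
Proof. by rewrite -(scale0r 0) dotZl mul0r. Qed.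

Lemma dot0r z : '[z, 0] = 0.
Proof. by rewrite dotC dot0l rmorph0. Qed.

Lemma dotNl x z : '[- x, z] = - '[x, z].
Proof. by rewrite -scaleN1r dotZl mulN1r. Qed.

Lemma dotNr x z : '[z, - x] = - '[z, x].
Proof. by rewrite dotC dotNl rmorphN /= -dotC. Qed.

Lemma dotBl x y z : '[x - y, z] = '[x, z] - '[y, z].
Proof. by rewrite dotDl dotNl. Qed.

Lemma dotBr x y z : '[z, x - y] = '[z, x] - '[z, y].
Proof. by rewrite dotDr dotNr. Qed.

Lemma dotxx x : '[x, x] = (nm x ^+ 2)%:C%C.
Proof. by rewrite -dot_normE normE rmorphXn. Qed.

Lemma Re_dotC x y : Re '[x, y] = Re '[y, x].
Proof. by rewrite (dotC y) conjC_conjc; case: (dot _ _ _). Qed.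

Lemma nm_dotC x y : nm '[x, y] = nm '[y, x].
Proof. by rewrite (dotC y) nm_conj. Qed.

Lemma nm_sqrD x y : nm (x + y) ^+ 2 = nm x ^+ 2 + nm y ^+ 2 + 2 * Re '[x, y].
Proof.
have sqrE z : nm z ^+ 2 = Re '[z, z] by rewrite dotxx.
by rewrite !sqrE dotDl !dotDr !ReD (Re_dotC y); ring.
Qed.

Lemma nm_sqrB x y : nm (x - y) ^+ 2 = nm x ^+ 2 + nm y ^+ 2 - 2 * Re '[x, y].
Proof. by rewrite nm_sqrD dotNr ReN nmN mulrN. Qed.

Lemma parallelogram x y :
  nm (x + y) ^+ 2 + nm (x - y) ^+ 2 = 2 * (nm x ^+ 2 + nm y ^+ 2).
Proof. by rewrite nm_sqrD nm_sqrB; ring. Qed.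

(** The real part of the quadratic form of T; the form itself is real when T is
    self-adjoint. *)
Definition qform T x : R := Re '[T x, x].

Definition selfadjoint T := forall x y, '[T x, y] = '[x, T y].

(** Over the complex numbers, positivity alone forces self-adjointness. *)
Lemma positive_selfadjoint P : linear P -> positive_op P -> selfadjoint P.
Proof.
move=> Plin Ppos x y.
have Im0 z : Im '[P z, z] = 0 by exact: ger0_Im (Ppos z).
have := Im0 (x + y); have := Im0 (x + 'i%C *: y).
rewrite !(linD Plin) !(linZ Plin) !dotDl !dotDr !dotZl !dotZr !ImD.
rewrite (dotC (P y) x) !conjC_conjc !Im0.
have := Im0 y; move: '[P x, y] '[P y, x] '[P y, y] => [u1 u2] [v1 v2] [w1 w2] /=.
move=> -> h1 h2.
by apply/eqP; rewrite eq_complex /=; apply/andP; split; apply/eqP; lra.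
Qed.

Lemma qform_real P x : positive_op P -> '[P x, x] = (qform P x)%:C%C.
Proof.
move=> Ppos; have := ger0_Im (Ppos x).
by rewrite /qform; case: ('[_, _]) => u v /= ->.
Qed.

Lemma qform_ge0 P x : positive_op P -> 0 <= qform P x.
Proof. by move=> Ppos; have := Ppos x; rewrite qform_real // ler0c. Qed.

Lemma qformB T x y : linear T -> selfadjoint T ->
  qform T (x - y) = qform T x + qform T y - 2 * Re '[T x, y].
Proof.
move=> Tlin Tsa; rewrite /qform (linB Tlin) dotBl !dotBr !(ReD, ReN) Tsa.
by rewrite [Re '[T y, x]]Re_dotC Tsa; ring.
Qed.

Lemma Re_conjM (w : C) (s : R) : Re (conjC (s%:C%C * w) * w) = s * nm w ^+ 2.
Proof. by rewrite nm_sqr conjC_conjc; case: w => u v /=; ring. Qed.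

Theorem positive_Cauchy_Schwarz P x y : linear P -> positive_op P ->
  nm '[P x, y] ^+ 2 <= qform P x * qform P y.
Proof.
move=> Plin Ppos; have Psa := positive_selfadjoint Plin Ppos.
apply: quadratic_ineq; rewrite ?sqr_ge0 ?qform_ge0 // => s.
have := qform_ge0 (x - (s%:C%C * '[P x, y]) *: y) Ppos.
rewrite qformB // dotZr Re_conjM {2}/qform (linZ Plin) dotZl dotZr.
rewrite qform_real // mulrCA mulrA [conjC _ * _]mulrC.
rewrite -normCK normE nmM nmR -rmorphXn -rmorphM /= exprMn real_normK ?num_real //.
by congr (_ <= _); ring.
Qed.

Lemma Cauchy_Schwarz x y : nm '[x, y] <= nm x * nm y.
Proof.
have idpos : positive_op (fun z : H => z).
  by move=> z; rewrite dotxx ler0c sqr_ge0.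
rewrite -(ler_pXn2r (ltn0Sn 1)) ?nnegrE ?mulr_ge0 ?nm_ge0 // exprMn.
have := positive_Cauchy_Schwarz x y (fun a u v => erefl) idpos.
by rewrite /qform !dotxx.
Qed.

Lemma dot_eq0 x y : (forall z, '[x, z] = '[y, z]) -> x = y.
Proof.
move=> h; apply/subr0_eq/nm0_eq0.
have : '[x - y, x - y] = 0 by rewrite dotBl h subrr.
by rewrite dotxx => -[/eqP]; rewrite sqrf_eq0 => /eqP ->.
Qed.

Lemma positive_ker P x : linear P -> positive_op P -> qform P x = 0 -> P x = 0.
Proof.
move=> Plin Ppos Px0; apply: dot_eq0 => z; rewrite dot0l.
apply: nm0_eq0; have := positive_Cauchy_Schwarz x z Plin Ppos.
rewrite Px0 mul0r => h; have := nm_ge0 '[P x, z].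
by move=> h0; rewrite leNgt; apply/negP => h1; nra.
Qed.

(** * Bounded operators *)

(** The operator norm of T is at most c. *)
Definition bounded_by T (c : R) := forall x, nm (T x) <= c * nm x.

Lemma bounded_op_bound T : bounded_op T -> exists2 c : R, 0 < c & bounded_by T c.
Proof.
move=> [Tlin Tcont].
pose f : {linear H -> H} := HB.pack T (GRing.isLinear.Build _ _ _ _ T Tlin).
have /linear_boundedP/pinfty_ex_gt0[c c0 cT] : bounded_near f (nbhs (0 : H)).
  by apply/linear_bounded_continuous => x; exact: Tcont.
have cE : c = (Re c)%:C%C.
  by move: c0; rewrite ltcE; case: (c) => a b /= /andP[/eqP -> _].
exists (Re c); first by move: c0; rewrite cE ltcR.
by move=> x; rewrite -lecR rmorphM /= -cE -!normE cT.
Qed.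

Lemma bounded_by_op T c : linear T -> bounded_by T c -> bounded_op T.
Proof.
move=> Tlin Tc; split=> //.
pose f : {linear H -> H} := HB.pack T (GRing.isLinear.Build _ _ _ _ T Tlin).
apply: (@bounded_linear_continuous _ _ _ f); apply/bounded_funP => r.
exists ((`|c| * nm (r : C))%:C%C) => x xr; rewrite normE lecR.
have nm_le : nm x <= nm r.
  rewrite -lecR -!normE ger0_norm //; exact: le_trans xr.
apply: le_trans (Tc x) _; apply: (@le_trans _ _ (`|c| * nm x)).
  by rewrite ler_wpM2r ?nm_ge0 // ler_norm.
by rewrite ler_wpM2l.
Qed.

Lemma bounded_comp S T c d : 0 <= c -> bounded_by S c -> bounded_by T d ->
  bounded_by (S \o T) (c * d).
Proof.
move=> c0 Sc Td x; apply: le_trans (Sc _) _.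
by rewrite -mulrA ler_wpM2l.
Qed.

Lemma linear_comp S T : linear S -> linear T -> linear (S \o T).
Proof. by move=> Slin Tlin a x y /=; rewrite Tlin Slin. Qed.

End InnerProduct.

(** * Orthogonal projection, Riesz representation and adjoints *)

Section Projection.
Context (R : realType) (Omega : Type) (H : functional_hilbert R Omega).
Local Notation C := R[i].
Local Notation "''[' x , y ]" := (dot H x y).
Local Notation Re := (@complex.Re R).
Implicit Types (x y z : H) (A S T : H -> H).

(** Linear subspaces, not necessarily closed. *)
Definition linear_subspace (V : set H) :=
  V 0 /\ forall (a : C) x y, V x -> V y -> V (a *: x + y).

(** Membership in the closure of V, for the norm. *)
Definition adherent (V : set H) x :=
  forall e : R, 0 < e -> exists2 v, V v & nm (x - v) < e.

(** If 0 is the point of V nearest to y, then y is orthogonal to V. *)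
Lemma nearest_orthogonal (V : set H) y : linear_subspace V ->
  (forall v, V v -> nm y <= nm (y - v)) -> forall v, V v -> '[y, v] = 0.
Proof.
move=> [V0 VD] ymin v Vv.
have : nm '[y, v] ^+ 2 <= 0 * nm v ^+ 2.
  apply: quadratic_ineq; rewrite ?sqr_ge0 // => s.
  have Vsv : V ((s%:C%C * '[y, v]) *: v) by rewrite -[X in V X]addr0; exact: VD.
  have := ymin _ Vsv; rewrite -(ler_pXn2r (ltn0Sn 1)) ?nnegrE ?nm_ge0 //.
  rewrite nm_sqrB dotZr Re_conjM nmZ nmM nmR !exprMn real_normK ?num_real //.
  by move=> h; lra.
rewrite mul0r => h; apply/nm0_eq0; have := nm_ge0 '[y, v].
by move=> h0; rewrite leNgt; apply/negP => h1; nra.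
Qed.

(** The Hilbert space is the sum of the closure of V and of the orthogonal
    complement of V. *)
Theorem orthogonal_projection (V : set H) x : linear_subspace V ->
  exists2 l, adherent V l & forall v, V v -> '[x - l, v] = 0.
Proof.
move=> Vsub; have [V0 VD] := Vsub.
pose E := [set nm (x - v) | v in V].
have E_inf : has_inf E.
  by split; [exists (nm (x - 0)), 0 | exists 0 => _ [v _ <-]; exact: nm_ge0].
pose d := inf E.
have d_le v : V v -> d <= nm (x - v).
  by move=> Vv; apply: (ge_inf E_inf.2); exists v.
have d_ge0 : 0 <= d.
  by apply: lb_le_inf; [case: E_inf | move=> _ [v _ <-]; exact: nm_ge0].
have near_inf (e : R) : 0 < e -> exists2 v, V v & nm (x - v) ^+ 2 < d ^+ 2 + e.
  move=> e0; have h : d < Num.sqrt (d ^+ 2 + e).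
    have d2 := sqr_ge0 d.
    by rewrite -{1}(ger0_norm d_ge0) -sqrtr_sqr ltr_sqrt; lra.
  have [_ [v Vv <-] hv] := @inf_lt _ E _ E_inf.1 h.
  exists v => //; have := nm_ge0 (x - v) => h0.
  rewrite -(@sqr_sqrtr _ (d ^+ 2 + e)); last by have := sqr_ge0 d; lra.
  by rewrite ltrXn2r // (lt_le_trans hv).
have [u uP] : {u : nat -> H & forall n, V (u n) /\
    nm (x - u n) ^+ 2 < d ^+ 2 + n.+1%:R^-1}.
  apply: (@choice _ _ (fun n v => V v /\ nm (x - v) ^+ 2 < d ^+ 2 + n.+1%:R^-1)).
  by move=> n; have [|v Vv vP] := near_inf n.+1%:R^-1;
    [rewrite invr_gt0 ltr0Sn | exists v].
have cauchy_u n m : (n <= m)%N ->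
    nm (u m - u n) <= Num.sqrt (4 * n.+1%:R^-1).
  move=> le_nm.
  have [[Vn hn] [Vm hm]] := (uP n, uP m).
  have le_inv : m.+1%:R^-1 <= n.+1%:R^-1 :> R.
    by rewrite lef_pV2 ?posrE ?ltr0Sn // ler_nat.
  have mid : d <= nm (x - (2^-1 *: u n + 2^-1 *: u m)).
    apply: d_le; apply: (VD) => //.
    by rewrite -[X in V X]addr0; apply: VD.
  have := parallelogram (x - u n) (x - u m).
  rewrite (_ : x - u n - (x - u m) = u m - u n); last first.
    by rewrite opprB addrC addrA subrK.
  rewrite (_ : _ + (x - u m) = 2 *: (x - (2^-1 *: u n + 2^-1 *: u m))); last first.
    rewrite scalerBr scalerDr !scalerA divff ?pnatr_eq0 // !scale1r.
    by rewrite scaler_nat mulr2n opprD !addrA; congr (_ - _); rewrite addrAC.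
  rewrite nmZ (_ : nm (2 : C) = 2); last first.
    by rewrite /nm normr_nat -[2]/(2%:R) raddfMn.
  rewrite exprMn => par.
  have : d ^+ 2 <= nm (x - (2^-1 *: u n + 2^-1 *: u m)) ^+ 2.
    by rewrite ler_pXn2r // ?nnegrE ?nm_ge0.
  move=> h; rewrite -(ger0_norm (nm_ge0 (u m - u n))) -sqrtr_sqr.
  apply: ler_wsqrtr; move: h par hn hm le_inv.
  move: (nm _ ^+ 2) (nm _ ^+ 2) (nm _ ^+ 2) (nm _ ^+ 2) (d ^+ 2) => a b c e f.
  by move: (n.+1%:R^-1) (m.+1%:R^-1) => g h; lra.
have small e : 0 < e -> exists n, Num.sqrt (4 * n.+1%:R^-1) < e :> R.
  move=> e0; have [|n hn] := @invn_small R (e ^+ 2 / 4).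
    by rewrite divr_gt0 ?exprn_gt0.
  exists n; rewrite -(ger0_norm (ltW e0)) -sqrtr_sqr ltr_sqrt ?exprn_gt0 //.
  by rewrite mulrC -ltr_pdivlMr.
have [l ul] := modulus_cvg cauchy_u small.
exists l => [e e0|].
  have [n hn] := small e e0.
  by exists (u n); [case: (uP n) | exact: le_lt_trans (ul n) hn].
apply: nearest_orthogonal => // v Vv.
apply/ler_addgt0Pl => e e0.
have [n hn] := small (e / 3) (divr_gt0 e0 (ltr0Sn _ 2)).
have [Vn xn] := uP n; have un := ul n.
have xn_le : nm (x - u n) <= d + e / 3.
  rewrite -(ler_pXn2r (ltn0Sn 1)) ?nnegrE ?nm_ge0 //; last by lra.
  have : 4 * n.+1%:R^-1 < (e / 3) ^+ 2 :> R.
    rewrite -[X in X < _]sqr_sqrtr ?mulr_ge0 ?invr_ge0 //.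
    by rewrite ltrXn2r ?sqrtr_ge0.
  have : 0 <= n.+1%:R^-1 :> R by rewrite invr_ge0.
  by move: xn; move: (n.+1%:R^-1) => g; nra.
have := d_le (u n + v); rewrite -[u n + v]addrC -{1}[v]scale1r => /(_ (VD _ _ _ Vv Vn)).
have := nmD (x - u n) (u n - l); rewrite addrA subrK (nmB (u n)).
have := nmD (x - l - v) (l - u n).
rewrite (_ : x - l - v + (l - u n) = x - (v + u n)); last first.
  by rewrite addrACA subrK -opprD.
by lra.
Qed.


(** A bounded functional that vanishes on V vanishes on the closure of V. *)
Lemma adherent_bounded (V : set H) (f : H -> C) (c : R) x :
  (forall y z, f (y - z) = f y - f z) -> (forall y, nm (f y) <= c * nm y) ->
  (forall v, V v -> f v = 0) -> adherent V x -> f x = 0.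
Proof.
move=> fB fc fV xV; apply: nm0_eq0; apply/ler_addgt0Pl => e e0; rewrite addr0.
have c1 : 0 < `|c| + 1 by rewrite ltr_wpDl.
have [v Vv xv] := xV (e / (`|c| + 1)) (divr_gt0 e0 c1).
have := fc (x - v); rewrite fB (fV _ Vv) subr0 => h.
rewrite (le_trans h) //; move: xv; rewrite ltr_pdivlMr // => xv.
have := nm_ge0 (x - v); have := ler_norm c; nra.
Qed.

Theorem Riesz_representation (f : H -> C) (c : R) :
  (forall a y z, f (a *: y + z) = a * f y + f z) ->
  (forall y, nm (f y) <= c * nm y) -> exists h, forall x, f x = '[x, h].
Proof.
move=> flin fc.
have fB y z : f (y - z) = f y - f z.
  by rewrite addrC -scaleN1r flin mulN1r addrC.
have f0 : f 0 = 0 by rewrite -(subrr 0) fB subrr.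
have [fN0|] := pselect (exists x, f x != 0); last first.
  move/forallNP => f_eq0; exists 0 => x; rewrite dot0r.
  by apply/eqP/negPn/negP; exact: f_eq0.
have [x fx] := fN0.
have ker_sub : linear_subspace [set v | f v = 0].
  by split=> [//|a y z /= fy fz]; rewrite flin fy fz mulr0 addr0.
have [l lV x_orth] := orthogonal_projection x ker_sub.
have fl : f l = 0 by apply: adherent_bounded fB fc _ lV.
set e := x - l in x_orth; have fe : f e = f x by rewrite fB fl subr0.
have ee : '[e, e] != 0.
  rewrite dotxx; apply: contra fx => /eqP[/eqP]; rewrite sqrf_eq0 => /eqP ne.
  by rewrite -fe (@nm0_eq0 _ _ e) ?ne // f0.
exists ((conjC (f x) / '[e, e]) *: e) => y.
have /x_orth : f (- (f y / f x) *: e + y) = 0.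
  by rewrite flin fe mulNr divfK // addNr.
rewrite dotC => /(congr1 conjC); rewrite conjCK rmorph0 dotDl dotZl.
move=> /eqP; rewrite mulNr addrC subr_eq0 dotZr => /eqP ->.
rewrite rmorphM fmorphV /= conjCK -dotC; field.
by rewrite fx ee.
Qed.

(** The adjoint of a bounded operator is not the default value of its
    definition. *)
Theorem adjoint_exists A : bounded_op A ->
  bounded_op (adjoint A) /\ forall x y, '[A x, y] = '[x, adjoint A y].
Proof.
move=> Abd; have [c c0 Ac] := bounded_op_bound Abd.
suff [S SP] : exists S, bounded_op S /\ forall x y, '[A x, y] = '[x, S y].
  exact: (@xgetI _ (cst 0) [set S : H -> H | bounded_op S /\
    forall x y, '[A x, y] = '[x, S y]] S SP).
have Alin := Abd.1.
have [S SP] : {S : H -> H & forall y x, '[A x, y] = '[x, S y]}.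
  apply: (@choice _ _ (fun y s => forall x, '[A x, y] = '[x, s])) => y.
  apply: (@Riesz_representation (fun x => '[A x, y]) (c * nm y)) => [a u v|x].
    by rewrite Alin dotDl dotZl.
  apply: le_trans (Cauchy_Schwarz _ _) _.
  by rewrite mulrAC ler_wpM2r ?nm_ge0.
exists S; split=> [|x y]; last exact: SP.
have Slin : linear S.
  move=> a u v; apply: dot_eq0 => z; rewrite [LHS]dotC [RHS]dotC -SP.
  by rewrite !dotDr !dotZr !SP.
apply: (bounded_by_op (c := c) Slin) => y.
have : nm (S y) ^+ 2 <= (c * nm (S y)) * nm y.
  have -> : nm (S y) ^+ 2 = complex.Re '[A (S y), y] by rewrite SP dotxx.
  apply: le_trans (Re_le_nm _) _; apply: le_trans (Cauchy_Schwarz _ _) _.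
  by rewrite ler_wpM2r ?nm_ge0.
have [Sy0|SyN0] := eqVneq (nm (S y)) 0.
  by rewrite Sy0 => _; rewrite mulr_ge0 ?nm_ge0 ?ltW.
have Sy_gt0 : 0 < nm (S y) by rewrite lt_def SyN0 nm_ge0.
by rewrite mulrAC expr2 ler_pM2r.
Qed.

Lemma adjoint_uniq A S : bounded_op A ->
  (forall x y, '[A x, y] = '[x, S y]) -> adjoint A = S.
Proof.
move=> /adjoint_exists[_ hA] hS; apply/funext => y; apply: dot_eq0 => z.
by rewrite dotC -hA hS -dotC.
Qed.

Lemma dot_adjoint A x y : bounded_op A -> '[adjoint A x, y] = '[x, A y].
Proof. by move=> /adjoint_exists[_ hA]; rewrite dotC -hA -dotC. Qed.

Lemma adjointK A : bounded_op A -> adjoint (adjoint A) = A.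
Proof.
move=> Abd; have [Bbd _] := adjoint_exists Abd.
by apply: adjoint_uniq => // x y; rewrite dot_adjoint.
Qed.

End Projection.

(** * Square roots and moduli of operators *)

Section SquareRoot.
Context (R : realType) (Omega : Type) (H : functional_hilbert R Omega).
Local Notation C := R[i].
Local Notation "''[' x , y ]" := (dot H x y).
Implicit Types (x y z : H) (A B P Q S T X Y : H -> H).

(** The scalar iteration that dominates the operator one; it increases to 1. *)
Fixpoint root_bound (n : nat) : R :=
  if n is m.+1 then (1 + root_bound m ^+ 2) / 2 else 0.

(** The iteration whose limit Y satisfies Y = (X + Y^2) / 2, so that
    (1 - Y)^2 = 1 - X. *)
Fixpoint root_iter X (n : nat) : H -> H :=
  if n is m.+1 then
    fun x => 2^-1 *: (X x + root_iter X m (root_iter X m x))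
  else fun=> 0.

Lemma root_bound_itv n : 0 <= root_bound n <= 1.
Proof. by elim: n => [|n /andP[? ?]] /=; apply/andP; split => //; nra. Qed.

Lemma root_bound_ge0 n : 0 <= root_bound n.
Proof. by case/andP: (root_bound_itv n). Qed.

Lemma root_bound_le1 n : root_bound n <= 1.
Proof. by case/andP: (root_bound_itv n). Qed.

Lemma root_bound_leS n : root_bound n <= root_bound n.+1.
Proof. by rewrite /=; have := root_bound_itv n; nra. Qed.

Lemma root_bound_cvg (n : nat) : 1 - root_bound n <= 2 / n.+1%:R.
Proof.
elim: n => [|n IH] /=; first by rewrite subr0 divr1 ler1n.
have n0 : 0 < n.+1%:R :> R by rewrite ltr0Sn.
rewrite ler_pdivlMr ?ltr0Sn // -[n.+2%:R]natr1.
have := root_bound_itv n; move: IH; rewrite ler_pdivlMr //.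
move: (root_bound n) (n.+1%:R) n0 => s k k0 h /andP[s0 s1].
have h2 : 0 <= (2 - (1 - s) * k) * (1 - (1 - s) / 2) by apply: mulr_ge0; lra.
by have := sqr_ge0 (1 - s); nra.
Qed.

Lemma le_root_bound0 (a K : R) : 0 <= K ->
  (forall n, a <= (1 - root_bound n) * K) -> a <= 0.
Proof.
move=> K0 h; apply/ler_addgt0Pl => e e0; rewrite addr0.
have [|n hn] := @invn_small R (e / (2 * (K + 1))).
  by rewrite divr_gt0 // mulr_gt0 // ltr_wpDl.
have := h n; have := root_bound_cvg n.
move: hn; rewrite ltr_pdivlMr ?mulr_gt0 ?ltr_wpDl //.
have : 0 <= n.+1%:R^-1 :> R by rewrite invr_ge0.
move: (n.+1%:R^-1) => g; have := root_bound_le1 n; nra.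
Qed.

Section Iteration.
Context (X : H -> H).
Hypotheses (X_lin : linear X) (X_bnd : bounded_by X 1).

Lemma root_iter_linear n : linear (root_iter X n).
Proof.
elim: n => [|n IH] a x y /=; first by rewrite scaler0 addr0.
rewrite X_lin !IH [a *: (_ *: _)]scalerA [a * _]mulrC -scalerA -scalerDr.
by congr (_ *: _); rewrite scalerDr addrACA.
Qed.

Lemma root_iter_bound n : bounded_by (root_iter X n) (root_bound n).
Proof.
elim: n => [|n IH] x /=; first by rewrite nm0 mul0r.
rewrite nmZ nm_half.
have := nmD (X x) (root_iter X n (root_iter X n x)).
have := X_bnd x; have := IH (root_iter X n x); have := IH x.
have := root_bound_ge0 n; have := nm_ge0 x; nra.
Qed.

Lemma root_iter_step n x :
  nm (root_iter X n.+1 x - root_iter X n x) <=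
    (root_bound n.+1 - root_bound n) * nm x.
Proof.
elim: n x => [|n IH] x.
  by rewrite !subr0; exact: (root_iter_bound 1).
have -> : root_iter X n.+2 x - root_iter X n.+1 x = 2^-1 *:
    (root_iter X n.+1 (root_iter X n.+1 x - root_iter X n x)
     + (root_iter X n.+1 (root_iter X n x) - root_iter X n (root_iter X n x))).
  rewrite (linB (root_iter_linear n.+1)) addrA subrK.
  rewrite [root_iter X n.+2 x]/(2^-1 *: (X x + root_iter X n.+1 (root_iter X n.+1 x))).
  rewrite [X in _ - X = _]/(2^-1 *: (X x + root_iter X n (root_iter X n x))).
  by rewrite -scalerBr opprD addrACA subrr add0r.
rewrite nmZ nm_half mulrC ler_pdivrMr //.
apply: le_trans (nmD _ _) _; apply: le_trans (lerD (root_iter_bound _ _) (IH _)) _.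
have := IH x; have := root_iter_bound n x; have := nm_ge0 x.
move: (root_bound_ge0 n) (root_bound_ge0 n.+1) (root_bound_leS n).
move: (nm (root_iter X n.+1 x - _)) (nm (root_iter X n x)) (nm x) => p q r.
have -> : root_bound n.+2 = (1 + root_bound n.+1 ^+ 2) / 2 by [].
have e : root_bound n.+1 = (1 + root_bound n ^+ 2) / 2 by [].
move: e; move: (root_bound n.+1) (root_bound n) => t s e s0 t0 st r0 hq hp.
have h1 : t * p <= t * ((t - s) * r) by rewrite ler_wpM2l.
have h2 : (t - s) * q <= (t - s) * (s * r) by rewrite ler_wpM2l ?subr_ge0.
have h3 : 2 * t * r = (1 + s ^+ 2) * r by rewrite e; field.
lra.
Qed.

Lemma root_iter_cauchy n m x : (n <= m)%N ->
  nm (root_iter X m x - root_iter X n x) <= (root_bound m - root_bound n) * nm x.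
Proof.
move=> /subnK <-; elim: (m - n)%N => [|k IH].
  by rewrite add0n !subrr mul0r nm0.
rewrite addSn -[root_iter X _ x](subrK (root_iter X (k + n) x)) -addrA.
by apply: le_trans (nmD _ _) _; have := root_iter_step (k + n) x; lra.
Qed.

Lemma root_iter_cvg : {Y : H -> H & forall x n,
  nm (Y x - root_iter X n x) <= (1 - root_bound n) * nm x}.
Proof.
apply: (@choice _ _ (fun x y => forall n,
  nm (y - root_iter X n x) <= (1 - root_bound n) * nm x)) => x.
apply: modulus_cvg => [n m nm_le|e e0].
  apply: le_trans (root_iter_cauchy _ nm_le) _.
  by rewrite ler_wpM2r ?nm_ge0 // lerB // root_bound_le1.
apply/not_existsP => h; suff : e <= 0 by rewrite leNgt e0.
apply: (@le_root_bound0 _ (nm x)) => [|n]; first exact: nm_ge0.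
by rewrite leNgt; apply/negP; exact: h.
Qed.

End Iteration.

Lemma root_bound_eq0 (V : normedZmodType C) (z : V) (K : R) : 0 <= K ->
  (forall n, nm z <= (1 - root_bound n) * K) -> z = 0.
Proof. by move=> K0 h; apply/nm0_eq0/(le_root_bound0 K0). Qed.

(** Y is the limit of the iteration attached to X. *)
Definition root_limit X Y := forall x n,
  nm (Y x - root_iter X n x) <= (1 - root_bound n) * nm x.

Section Limit.
Context (X Y : H -> H).
Hypotheses (X_lin : linear X) (X_bnd : bounded_by X 1) (XY : root_limit X Y).

Lemma root_limit_bound : bounded_by Y 1.
Proof. by move=> x; have := XY x 0; rewrite /= !subr0. Qed.

Lemma root_limit_linear : linear Y.
Proof.
move=> a x y; apply/subr0_eq.
apply: (@root_bound_eq0 _ _ (nm (a *: x + y) + nm a * nm x + nm y)).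
  by rewrite !addr_ge0 ?mulr_ge0 ?nm_ge0.
move=> n; pose Z := root_iter X n.
have -> : Y (a *: x + y) - (a *: Y x + Y y) =
    (Y (a *: x + y) - Z (a *: x + y)) + - (a *: (Y x - Z x)) + - (Y y - Z y).
  have -> : Z (a *: x + y) = a *: Z x + Z y by exact: root_iter_linear.
  by apply: (@dot_eq0 _ _ H) => w; rewrite !(dotDl, dotNl, dotZl); ring.
apply: le_trans (nmD _ _) _; apply: le_trans (lerD (nmD _ _) (lexx _)) _.
rewrite !nmN nmZ !mulrDr mulrCA !lerD ?XY //.
by rewrite ler_wpM2l ?nm_ge0 ?XY.
Qed.

Lemma root_iter_selfadjoint n : selfadjoint X -> selfadjoint (root_iter X n).
Proof.
move=> Xsa; elim: n => [|n IH] x y /=; first by rewrite dot0l dot0r.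
rewrite dotZl dotZr dotDl dotDr Xsa !IH; congr (_ * _).
by rewrite fmorphV rmorph_nat.
Qed.

Lemma root_limit_selfadjoint : selfadjoint X -> selfadjoint Y.
Proof.
move=> Xsa x y; apply/subr0_eq.
apply: (@root_bound_eq0 _ _ (2 * (nm x * nm y))).
  by rewrite !mulr_ge0 ?nm_ge0.
move=> n; pose Z := root_iter X n.
have -> : '[Y x, y] - '[x, Y y] = '[Y x - Z x, y] - '[x, Y y - Z y].
  by rewrite dotBl dotBr (root_iter_selfadjoint n Xsa); ring.
apply: le_trans (nmD _ _) _; rewrite nmN.
apply: le_trans (lerD (Cauchy_Schwarz _ _) (Cauchy_Schwarz _ _)) _.
have h1 : nm (Y x - Z x) * nm y <= (1 - root_bound n) * nm x * nm y.
  by rewrite ler_wpM2r ?nm_ge0 ?XY.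
have h2 : nm x * nm (Y y - Z y) <= nm x * ((1 - root_bound n) * nm y).
  by rewrite ler_wpM2l ?nm_ge0 ?XY.
lra.
Qed.

Lemma root_limit_eq x : Y x = 2^-1 *: (X x + Y (Y x)).
Proof.
apply/subr0_eq.
apply: (@root_bound_eq0 _ _ (2 * nm x)); first by rewrite mulr_ge0 ?nm_ge0.
move=> n; pose Z := root_iter X n.
have -> : Y x - 2^-1 *: (X x + Y (Y x)) =
    (Y x - root_iter X n.+1 x) - 2^-1 *: (Z (Y x - Z x) + (Y (Y x) - Z (Y x))).
  rewrite /Z (linB (root_iter_linear X_lin n)) [root_iter X n.+1 x]/=.
  by apply: (@dot_eq0 _ _ H) => w; rewrite !(dotDl, dotNl, dotZl); ring.
apply: le_trans (nmD _ _) _; rewrite nmN nmZ nm_half.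
have h := nmD (Z (Y x - Z x)) (Y (Y x) - Z (Y x)).
have h1 := root_iter_bound X_bnd n (Y x - Z x).
have h2 := XY x n; have h3 := XY (Y x) n; have h4 := XY x n.+1.
have h5 := root_limit_bound x; have h6 := root_bound_leS n.
have := root_bound_ge0 n; have := root_bound_le1 n.
rewrite -/Z in h1 h2 h3 h4 *; have := nm_ge0 x; have := nm_ge0 (Y x - Z x).
move: h h1 h2 h3 h4 h5 h6.
move: (nm (Z _)) (nm (Y (Y x) - _)) (nm (Y x - Z x)) (nm (_ + _)) => a b c d.
move: (nm (Y x - _)) (nm (Y x)) (nm x) => e f g.
move: (root_bound n) (root_bound n.+1) => s t h h1 h2 h3 h4 h5 h6 c0 g0 s1 s0.
have k1 : s * c <= 1 * c by rewrite ler_wpM2r.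
have k2 : (1 - s) * f <= (1 - s) * (1 * g) by rewrite ler_wpM2l ?subr_ge0.
have k3 : (1 - t) * g <= (1 - s) * g by rewrite ler_wpM2r // lerB.
lra.
Qed.

End Limit.

(** An operator that intertwines X and X' intertwines the iterates, hence the
    limits. *)
Lemma root_limit_intertwine (T X Y X' Y' : H -> H) (c : R) :
  linear X -> bounded_by X 1 -> root_limit X Y ->
  linear X' -> bounded_by X' 1 -> root_limit X' Y' ->
  linear T -> bounded_by T c -> 0 <= c ->
  (forall x, T (X x) = X' (T x)) -> forall x, T (Y x) = Y' (T x).
Proof.
move=> Xlin Xb XY Xlin' Xb' XY' Tlin Tc c0 TX x; apply/subr0_eq.
have TZ n y : T (root_iter X n y) = root_iter X' n (T y).
  elim: n y => [|n IH] y /=; first exact: lin0 Tlin.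
  by rewrite (linZ Tlin) (linD Tlin) TX !IH.
apply: (@root_bound_eq0 _ _ (2 * (c * nm x))).
  by rewrite !mulr_ge0 ?nm_ge0.
move=> n.
have -> : T (Y x) - Y' (T x) =
    T (Y x - root_iter X n x) - (Y' (T x) - root_iter X' n (T x)).
  by rewrite (linB Tlin) TZ opprB addrA subrK.
apply: le_trans (nmD _ _) _; rewrite nmN.
have h1 := Tc (Y x - root_iter X n x).
have h2 : c * nm (Y x - root_iter X n x) <= c * ((1 - root_bound n) * nm x).
  by rewrite ler_wpM2l.
have h3 := XY' (T x) n.
have h4 : (1 - root_bound n) * nm (T x) <= (1 - root_bound n) * (c * nm x).
  by rewrite ler_wpM2l ?subr_ge0 ?root_bound_le1.
lra.
Qed.

End SquareRoot.

Section Modulus.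
Context (R : realType) (Omega : Type) (H : functional_hilbert R Omega).
Local Notation C := R[i].
Local Notation "''[' x , y ]" := (dot H x y).
Local Notation Re := (@complex.Re R).
Local Notation Im := (@complex.Im R).
Implicit Types (x y z : H) (A B P Q S T X Y : H -> H) (c : R).

(** The operator 1 - T / c^2; it is a contraction as soon as T = A^* A with A^*
    bounded by c. *)
Definition contr c T : H -> H := fun x => x - (c ^- 2)%:C%C *: T x.

Lemma contr_linear c T : linear T -> linear (contr c T).
Proof.
move=> Tlin a x y; rewrite /contr (linD Tlin) (linZ Tlin).
by apply: (@dot_eq0 _ _ H) => w; rewrite !(dotDl, dotNl, dotZl); ring.
Qed.

Lemma conj_real (a : R) : conjC (a%:C%C : C) = a%:C%C.
Proof. exact: conjc_real. Qed.

Lemma contr_selfadjoint c T : selfadjoint T -> selfadjoint (contr c T).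
Proof.
by move=> Tsa x y; rewrite dotBl dotBr dotZl dotZr Tsa conj_real.
Qed.

Lemma adjoint_comp_bounded A : bounded_op A -> bounded_op (adjoint A \o A).
Proof.
move=> Abd; have [A'bd _] := adjoint_exists Abd.
have [c c0 Ac] := bounded_op_bound Abd.
have [d d0 Ad] := bounded_op_bound A'bd.
apply: (bounded_by_op (c := d * c)).
  by apply: linear_comp; [case: A'bd | case: Abd].
by apply: bounded_comp => //; exact: ltW.
Qed.

Lemma adjoint_comp_selfadjoint A : bounded_op A -> selfadjoint (adjoint A \o A).
Proof.
move=> Abd x y /=; rewrite dot_adjoint //.
by have [_ ->] := adjoint_exists Abd.
Qed.

Lemma contr_bound c A : 0 < c -> bounded_op A -> bounded_by (adjoint A) c ->
  bounded_by (contr c (adjoint A \o A)) 1.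
Proof.
move=> c0 Abd A'c x; rewrite mul1r -(ler_pXn2r (ltn0Sn 1)) ?nnegrE ?nm_ge0 //.
rewrite nm_sqrB dotZr conj_real /= nmZ nmR ger0_norm; last first.
  by rewrite invr_ge0 exprn_ge0 ?ltW.
rewrite -(adjoint_exists Abd).2 dotxx.
rewrite -rmorphM [complex.Re _]/= exprMn -exprVn.
have h := A'c (A x); have a0 := nm_ge0 (A x); have b0 := nm_ge0 (adjoint A (A x)).
have kc : c^-1 * c = 1 by rewrite mulVf // gt_eqF.
have {}h : c^-1 * nm (adjoint A (A x)) <= nm (A x).
  by rewrite mulrC ler_pdivrMr // mulrC.
have k0 : 0 <= c^-1 by rewrite invr_ge0 ltW.
have h2 : (c^-1 * nm (adjoint A (A x))) ^+ 2 <= nm (A x) ^+ 2.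
  by rewrite ler_pXn2r ?nnegrE ?mulr_ge0.
have h3 : c^-1 ^+ 2 * (c^-1 * nm (adjoint A (A x))) ^+ 2 <= c^-1 ^+ 2 * nm (A x) ^+ 2.
  by rewrite ler_wpM2l ?sqr_ge0.
have h4 : 0 <= c^-1 ^+ 2 * nm (A x) ^+ 2 by rewrite mulr_ge0 ?sqr_ge0.
move: h3 h4; rewrite exprMn; move: (c^-1) (nm _) (nm _) (nm _) => k p q r.
by move=> h3 h4; nra.
Qed.

(** P = c (1 - Y), where Y is the limit of the iteration for 1 - T / c^2; this is
    a square root of T. *)
Definition root_of c T P := exists2 Y,
  root_limit (contr c T) Y & forall x, P x = c%:C%C *: (x - Y x).

Lemma root_of_exists c T : linear T -> bounded_by (contr c T) 1 ->
  exists P, root_of c T P.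
Proof.
move=> Tlin Tc; have [Y hY] := root_iter_cvg (contr_linear _ Tlin) Tc.
by exists (fun x => c%:C%C *: (x - Y x)), Y.
Qed.

Section RootOf.
Context (c : R) (T P : H -> H).
Hypotheses (c_gt0 : 0 < c) (T_lin : linear T) (T_sa : selfadjoint T).
Hypotheses (T_c : bounded_by (contr c T) 1) (TP : root_of c T P).

Lemma root_of_linear : linear P.
Proof.
case: TP => Y hY hP a x y.
have Ylin := root_limit_linear (contr_linear _ T_lin) hY.
rewrite !hP (linD Ylin) (linZ Ylin).
by apply: (@dot_eq0 _ _ H) => w; rewrite !(dotDl, dotNl, dotZl); ring.
Qed.

Lemma root_of_bounded : bounded_op P.
Proof.
apply: (bounded_by_op (c := c * 2)) root_of_linear _.
case: TP => Y hY hP x; rewrite hP nmZ nmR gtr0_norm // -mulrA.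
apply: ler_wpM2l; [exact: ltW | apply: le_trans (nmD _ _) _; rewrite nmN].
by have := root_limit_bound hY x; lra.
Qed.

Lemma root_of_positive : positive_op P.
Proof.
case: TP => Y hY hP x; rewrite hP dotZl; apply: mulr_ge0; first by rewrite ler0c ltW.
have Ysa := root_limit_selfadjoint hY (contr_selfadjoint _ T_sa).
have ImY : Im '[Y x, x] = 0.
  have := Ysa x x; rewrite [RHS]dotC conjC_conjc.
  by case: ('[_, _]) => a b /= [h]; lra.
have ReY : Re '[Y x, x] <= nm x ^+ 2.
  apply: le_trans (Re_le_nm _) _; apply: le_trans (Cauchy_Schwarz _ _) _.
  by rewrite expr2 ler_wpM2r ?nm_ge0 //; have := root_limit_bound hY x; lra.
rewrite dotBl dotxx lecE; apply/andP; split.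
  by rewrite ImD ImN ImY subr0.
by rewrite ReD ReN /= subr_ge0.
Qed.

Lemma root_of_sqr : P \o P = T.
Proof.
apply/funext => x /=; case: (TP) => Y hY hP.
have Ylin := root_limit_linear (contr_linear _ T_lin) hY.
have YY : Y (Y x) = 2 *: Y x - contr c T x.
  rewrite [X in 2 *: X](root_limit_eq (contr_linear _ T_lin) T_c hY) scalerA.
  by rewrite divff ?pnatr_eq0 // scale1r addrC addKr.
rewrite !hP (linZ Ylin) (linB Ylin) YY /contr.
have cc : (c%:C%C : C) * c%:C%C * (c ^- 2)%:C%C = 1.
  by rewrite -!rmorphM -expr2 divff // expf_neq0 // gt_eqF.
apply: (@dot_eq0 _ _ H) => w; rewrite !(dotDl, dotNl, dotZl).
transitivity (c%:C%C * c%:C%C * (c ^- 2)%:C%C * '[T x, w]).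
  by ring.
by rewrite cc mul1r.
Qed.

End RootOf.

Lemma root_of_intertwine c T T' P P' S : linear T -> linear T' ->
  bounded_by (contr c T) 1 -> bounded_by (contr c T') 1 ->
  root_of c T P -> root_of c T' P' -> bounded_op S ->
  (forall x, S (T x) = T' (S x)) -> forall x, S (P x) = P' (S x).
Proof.
move=> Tlin T'lin Tc T'c [Y hY hP] [Y' hY' hP'] Sbd ST x.
have [d d0 Sd] := bounded_op_bound Sbd; have Slin := Sbd.1.
rewrite hP hP' (linZ Slin) (linB Slin); congr (_ *: (_ - _)).
apply: (root_limit_intertwine (contr_linear _ Tlin) Tc hY
  (contr_linear _ T'lin) T'c hY' Slin Sd (ltW d0)) => y.
by rewrite /contr (linB Slin) (linZ Slin) ST.
Qed.

(** With y = P x - Q x, the sum of <P y, y> and <Q y, y> is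
    <P^2 x - Q^2 x, y> = 0; hence P y = Q y = 0 and |y|^2 = <x, P y - Q y> = 0. *)
Lemma positive_sqr_inj P Q : linear P -> linear Q ->
  positive_op P -> positive_op Q ->
  (forall x, P (Q x) = Q (P x)) -> P \o P = Q \o Q -> P = Q.
Proof.
move=> Plin Qlin Ppos Qpos PQ PPQQ; apply/funext => x; apply/subr0_eq.
set y := P x - Q x.
have sq z : P (P z) = Q (Q z) by rewrite -[LHS]/((P \o P) z) PPQQ.
have h : qform P y + qform Q y = 0.
  rewrite /qform -ReD -dotDl (linB Plin) (linB Qlin) sq PQ.
  by rewrite addrA subrK subrr dot0l.
have Py : P y = 0.
  by apply: positive_ker => //; have := qform_ge0 y Ppos; have := qform_ge0 y Qpos; lra.
have Qy : Q y = 0.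
  by apply: positive_ker => //; have := qform_ge0 y Ppos; have := qform_ge0 y Qpos; lra.
apply/nm0_eq0; suff : nm y ^+ 2 = 0 by move/eqP; rewrite sqrf_eq0 => /eqP ->.
have -> : nm y ^+ 2 = Re '[P x - Q x, y] by rewrite -/y dotxx.
rewrite dotBl (positive_selfadjoint Plin Ppos) (positive_selfadjoint Qlin Qpos).
by rewrite Py Qy !dot0r subrr.
Qed.

(** The modulus is not the default value of its definition, and it is given by
    the iteration at any scale c that bounds the adjoint of A. *)
Theorem abs_opP A : bounded_op A ->
  [/\ bounded_op (abs_op A), positive_op (abs_op A),
      abs_op A \o abs_op A = adjoint A \o A &
      forall c, 0 < c -> bounded_by (adjoint A) c ->
        root_of c (adjoint A \o A) (abs_op A)].
Proof.
move=> Abd; have [A'bd _] := adjoint_exists Abd.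
have Tbd := adjoint_comp_bounded Abd; have Tlin := Tbd.1.
have Tsa := adjoint_comp_selfadjoint Abd.
have root c : 0 < c -> bounded_by (adjoint A) c ->
    exists P, root_of c (adjoint A \o A) P.
  by move=> c0 Ac; exact: root_of_exists Tlin (contr_bound c0 Abd Ac).
have [d d0 Ad] := bounded_op_bound A'bd; have [P0 hP0] := root d d0 Ad.
have Tc := contr_bound d0 Abd Ad.
have [Pbd Ppos Psq] : [set P : H -> H | [/\ bounded_op P, positive_op P &
    P \o P = adjoint A \o A]] (abs_op A).
  apply: (@xgetI _ (cst 0) [set P : H -> H | [/\ bounded_op P, positive_op P &
    P \o P = adjoint A \o A]] P0); split.
  - exact: root_of_bounded d0 Tlin hP0.
  - exact: root_of_positive d0 Tsa hP0.
  - exact: root_of_sqr d0 Tlin Tc hP0.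
split=> // c c0 Ac; have [Q hQ] := root c c0 Ac.
have Tc' := contr_bound c0 Abd Ac.
suff -> : abs_op A = Q by [].
apply: positive_sqr_inj.
- exact: Pbd.1.
- exact: root_of_linear Tlin hQ.
- exact: Ppos.
- exact: root_of_positive c0 Tsa hQ.
- by apply: (root_of_intertwine Tlin Tlin Tc' Tc' hQ hQ Pbd) => x; rewrite -Psq.
- by rewrite Psq (root_of_sqr c0 Tlin Tc' hQ).
Qed.

(** Both moduli are limits at a common scale, and A intertwines A^* A with
    A A^*. *)
Theorem abs_op_intertwine A x : bounded_op A ->
  A (abs_op A x) = abs_op (adjoint A) (A x).
Proof.
move=> Abd; have [A'bd _] := adjoint_exists Abd; have AK := adjointK Abd.
have [c c0 Ac] := bounded_op_bound Abd.
have [d d0 Ad] := bounded_op_bound A'bd.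
have cd0 : 0 < c + d by rewrite addr_gt0.
have {}Ac : bounded_by A (c + d).
  by move=> y; have := Ac y; have := nm_ge0 y; nra.
have {}Ad : bounded_by (adjoint A) (c + d).
  by move=> y; have := Ad y; have := nm_ge0 y; nra.
have [_ _ _ /(_ _ cd0 Ad) root] := abs_opP Abd.
have [_ _ _] := abs_opP A'bd; rewrite AK => /(_ _ cd0 Ac) root'.
have Tc := contr_bound cd0 Abd Ad.
have := contr_bound cd0 A'bd; rewrite AK => /(_ Ac) T'c.
have Tlin := (adjoint_comp_bounded Abd).1.
have := (adjoint_comp_bounded A'bd).1; rewrite AK => T'lin.
exact: (root_of_intertwine Tlin T'lin Tc T'c root root' Abd).
Qed.

(** Nonnegativity passes to the closure for functions with the Lipschitz
    estimate of a bounded quadratic form. *)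
Lemma adherent_ge0 (V : set H) (f : H -> R) (c : R) l :
  (forall x v, f x - f v <= c * nm (x - v) * (nm x + nm v)) ->
  (forall v, V v -> 0 <= f v) -> adherent V l -> 0 <= f l.
Proof.
move=> fc fV lV; rewrite -oppr_le0; apply/ler_addgt0Pl => e e0; rewrite addr0.
set M := (`|c| + 1) * (2 * nm l + 1).
have M0 : 0 < M.
  by apply: mulr_gt0; [have := normr_ge0 c | have := nm_ge0 l]; lra.
have [|v Vv lv] := lV (minr 1 (e / M)).
  by rewrite lt_min ltr01 divr_gt0.
move: lv; rewrite lt_min ltr_pdivlMr // => /andP[lv1 lvM].
have := fc v l; rewrite nmB; have := fV v Vv.
have nv : nm v <= nm l + nm (l - v).
  by have := nmD l (v - l); rewrite (addrC l) subrK (nmB v).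
have := nm_ge0 (l - v); have := nm_ge0 l; have := nm_ge0 v.
move: lv1 lvM nv; rewrite /M; move: (ler_norm c) (normr_ge0 c).
move: (nm (l - v)) (nm l) (nm v) (`|c|) => d r s k kc k0 d1 dM sr s0 r0 d0 fv0 h.
have h1 : c * d * (s + r) <= k * d * (s + r).
  by apply: ler_wpM2r; [exact: addr_ge0 | exact: ler_wpM2r].
have h2 : k * d * (s + r) <= k * d * (2 * r + 1).
  by apply: ler_wpM2l; [exact: mulr_ge0 | lra].
have h3 : 0 <= d * (2 * r + 1) by apply: mulr_ge0 => //; lra.
lra.
Qed.

(** Mixed Schwarz inequality. For z in the range of |A| it is the
    Cauchy-Schwarz inequality of |A^*|; it extends to the closure of that range
    by continuity and to its orthogonal complement, where A vanishes. *)
Theorem mixed_Schwarz A z y : bounded_op A ->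
  nm '[A z, y] ^+ 2 <= qform (abs_op A) z * qform (abs_op (adjoint A)) y.
Proof.
move=> Abd; have [A'bd hA] := adjoint_exists Abd; have AK := adjointK Abd.
have [Pbd Ppos Psq _] := abs_opP Abd; have [Qbd Qpos Qsq _] := abs_opP A'bd.
set P := abs_op A in Pbd Ppos Psq *; set Q := abs_op (adjoint A) in Qbd Qpos Qsq *.
have Psa := positive_selfadjoint Pbd.1 Ppos.
have APQA x : A (P x) = Q (A x) by exact: abs_op_intertwine.
have PP x : P (P x) = adjoint A (A x) by rewrite -[LHS]/((P \o P) x) Psq.
have on_range w : nm '[A (P w), y] ^+ 2 <= qform P (P w) * qform Q y.
  rewrite APQA; apply: le_trans (positive_Cauchy_Schwarz _ _ Qbd.1 Qpos) _.
  rewrite ler_wpM2r ?qform_ge0 // /qform -APQA hA -PP Psa.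
  by rewrite [X in X <= _]Re_dotC -Psa.
have rg_sub : linear_subspace [set v | exists w, v = P w].
  split=> [|a u v /= [u' ->] [v' ->]]; first by exists 0; rewrite (lin0 Pbd.1).
  by exists (a *: u' + v'); rewrite Pbd.1.
have [l l_adh l_orth] := orthogonal_projection z rg_sub.
have Pe : P (z - l) = 0.
  by apply: (@dot_eq0 _ _ H) => w; rewrite Psa dot0l l_orth //; exists w.
have Ae : A (z - l) = 0.
  apply/nm0_eq0; suff : nm (A (z - l)) ^+ 2 = 0.
    by move/eqP; rewrite sqrf_eq0 => /eqP ->.
  have -> : nm (A (z - l)) ^+ 2 = Re '[A (z - l), A (z - l)] by rewrite dotxx.
  by rewrite hA -PP Pe (lin0 Pbd.1) dot0r.
have -> : A z = A l.
  by apply/subr0_eq; rewrite -(linB Abd.1).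
have -> : qform P z = qform P l.
  have Pz : P z = P l by apply/subr0_eq; rewrite -(linB Pbd.1).
  by rewrite /qform Pz !Psa Pz.
rewrite -subr_ge0.
have [p p0 Pp] := bounded_op_bound Pbd; have [a a0 Aa] := bounded_op_bound Abd.
apply: (@adherent_ge0 _ (fun x => qform P x * qform Q y - nm '[A x, y] ^+ 2)
  (p * qform Q y + (a * nm y) ^+ 2) l _ _ l_adh) => [x v|_ [w ->]].
  have K0 := qform_ge0 y Qpos; move: (qform Q y) K0 => K K0.
  have h1 : qform P x - qform P v <= p * nm (x - v) * (nm x + nm v).
    have -> : qform P x - qform P v = Re '[P (x - v), x] + Re '[P (x - v), v].
      by rewrite /qform (linB Pbd.1) !dotBl !ReD !ReN (Psa v x) (Re_dotC v (P x)); ring.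
    rewrite mulrDr lerD // (le_trans (Re_le_nm _)) //
      (le_trans (Cauchy_Schwarz _ _)) //; by rewrite ler_wpM2r ?nm_ge0.
  have h2 u : nm '[A u, y] <= a * nm y * nm u.
    apply: le_trans (Cauchy_Schwarz _ _) _.
    by rewrite mulrAC ler_wpM2r ?nm_ge0.
  have h3 : nm '[A v, y] ^+ 2 - nm '[A x, y] ^+ 2 <=
      (a * nm y * nm (x - v)) * (a * nm y * (nm x + nm v)).
    have h4 : nm '[A v, y] - nm '[A x, y] <= a * nm y * nm (x - v).
      have := nmD '[A (v - x), y] '[A x, y].
      rewrite -dotDl (linB Abd.1) subrK -(linB Abd.1) => h.
      by have := h2 (v - x); rewrite nmB; lra.
    have := h2 x; have := h2 v; have := h2 (x - v).
    have := nm_ge0 '[A x, y]; have := nm_ge0 '[A v, y].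
    have [le|gt] := leP (nm '[A v, y]) (nm '[A x, y]).
      move=> u1 u2 u3 u4 u5; apply: (@le_trans _ _ 0).
        by rewrite subr_le0 ler_pXn2r.
      by rewrite !mulr_ge0 ?addr_ge0 ?nm_ge0 ?ltW.
    move=> u1 u2 u3 u4 u5; rewrite subr_sqr.
    apply: ler_pM => //; [by rewrite subr_ge0 ltW | exact: addr_ge0 | lra].
  have h5 : (qform P x - qform P v) * K <= p * nm (x - v) * (nm x + nm v) * K.
    by rewrite ler_wpM2r.
  lra.
by rewrite subr_ge0.
Qed.

End Modulus.

(** * Symmetrizable operators and the spectral radius *)

(** The ratios of a logarithmically convex sequence increase, so its first ratio
    is at most its geometric growth rate. *)
Lemma log_convex_growth (R : realType) (a : nat -> R) (K r : R) :
  0 < r -> (forall n, 0 <= a n) -> (forall n, a n <= K * r ^+ n) ->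
  (forall n, a n.+1 ^+ 2 <= a n * a n.+2) -> a 1%N <= r * a 0%N.
Proof.
move=> r0 a0 aK aconv.
have [a00|a00] := eqVneq (a 0%N) 0.
  have := aconv 0%N; rewrite a00 mul0r mulr0 => h; have := a0 1%N.
  by move=> h0; rewrite leNgt; apply/negP => h1; nra.
have a_gt0 : 0 < a 0%N by rewrite lt_def a00 a0.
rewrite leNgt; apply/negP => lt_a.
have a1_gt0 : 0 < a 1%N by apply: lt_trans lt_a; exact: mulr_gt0.
pose q := a 1%N / (r * a 0%N).
have q1 : 1 < q by rewrite ltr_pdivlMr ?mulr_gt0 // mul1r.
have q0 : 0 < q by apply: lt_trans q1.
have step n : 0 < a n /\ q * r * a n <= a n.+1.
  elim: n => [|n [an IH]].
    split=> //; rewrite [X in X <= _](_ : _ = a 1%N) // /q; field.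
    by rewrite !gt_eqF.
  have an1 : 0 < a n.+1 by apply: lt_le_trans IH; do 2 apply: mulr_gt0 => //.
  split=> //; have := aconv n; rewrite -(ler_pM2l an) => h.
  have h2 : a n * (q * r * a n.+1) <= a n.+1 * a n.+1.
    by rewrite mulrCA mulrA ler_wpM2r // ltW.
  by rewrite -(ler_pM2l an); apply: le_trans h2 _; rewrite -expr2.
have grow n : q ^+ n * (r ^+ n * a 0%N) <= a n.
  elim: n => [|n IH]; first by rewrite !expr0 !mul1r.
  have [_] := step n; apply: le_trans; rewrite !exprS.
  have -> : q * q ^+ n * (r * r ^+ n * a 0%N) = q * r * (q ^+ n * (r ^+ n * a 0%N)).
    by ring.
  by rewrite ler_pM2l // mulr_gt0.
have bern n : 1 + n%:R * (q - 1) <= q ^+ n.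
  elim: n => [|n IH]; first by rewrite expr0 mul0r addr0.
  rewrite exprS -natr1; have n0 : 0 <= n%:R :> R by [].
  have := ler_wpM2l (ltW q0) IH.
  move: (n%:R) n0 (q ^+ n) => m m0 p h; apply: le_trans h.
  have : 0 <= m * (q - 1) ^+ 2 by rewrite mulr_ge0 ?sqr_ge0.
  lra.
have q1' : 0 < q - 1 by rewrite subr_gt0.
have K0 : 0 <= K / a 0%N.
  rewrite divr_ge0 ?ltW //; have := aK 0%N; rewrite expr0 mulr1.
  by have := a0 0%N; lra.
have := archi_boundP (divr_ge0 K0 (ltW q1')); set n := Num.bound _.
rewrite ltr_pdivrMr // ltr_pdivrMr // => hK.
have := le_trans (grow n) (aK n).
rewrite mulrCA mulrC ler_pM2r ?exprn_gt0 // => h.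
have := bern n; rewrite -(ler_pM2r a_gt0) => h2; lra.
Qed.

Section Symmetrizable.
Context (R : realType) (Omega : Type) (H : functional_hilbert R Omega).
Local Notation C := R[i].
Local Notation "''[' x , y ]" := (dot H x y).
Local Notation Re := (@complex.Re R).
Implicit Types (x y z : H) (A B P Q S T X Y : H -> H) (c : R).

(** S is self-adjoint for the semi-inner product of P. *)
Definition symmetrized P S := forall x y, '[P (S x), y] = '[P x, S y].

Lemma Re_realM (a : R) (z : C) : Re (a%:C%C * z) = a * Re z.
Proof. by case: z => u v /=; ring. Qed.

Lemma qform_sym P S x : symmetrized P S -> qform P (S x) = Re '[P x, S (S x)].
Proof. by move=> PS; rewrite /qform PS. Qed.

(** Reid's inequality. The Cauchy-Schwarz inequality makes the sequence
    <P S^n x, S^n x> logarithmically convex, and it is O(c^(2n)). *)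
Theorem Reid_inequality P S c x : bounded_op P -> positive_op P ->
  symmetrized P S -> 0 < c -> bounded_by S c ->
  qform P (S x) <= c ^+ 2 * qform P x.
Proof.
move=> Pbd Ppos PS c0 Sc; have [p p0 Pp] := bounded_op_bound Pbd.
apply: (@log_convex_growth _ (fun n => qform P (iter n S x)) (p * nm x ^+ 2)).
- by rewrite exprn_gt0.
- by move=> n; exact: qform_ge0.
- move=> n; have Sn : nm (iter n S x) <= c ^+ n * nm x.
    elim: n => [|n IH] /=; first by rewrite expr0 mul1r.
    by apply: le_trans (Sc _) _; rewrite exprS -mulrA ler_wpM2l // ltW.
  apply: le_trans (Re_le_nm _) _; apply: le_trans (Cauchy_Schwarz _ _) _.
  apply: (@le_trans _ _ (p * nm (iter n S x) ^+ 2)).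
    by rewrite expr2 mulrA ler_wpM2r ?nm_ge0.
  rewrite -mulrA ler_wpM2l ?(ltW p0) // exprAC -exprMn mulrC.
  have cn0 : 0 <= c ^+ n by rewrite exprn_ge0 // ltW.
  by rewrite ler_pXn2r ?nnegrE ?mulr_ge0 ?nm_ge0.
- move=> n /=; rewrite qform_sym //.
  apply: le_trans (positive_Cauchy_Schwarz _ _ Pbd.1 Ppos).
  rewrite -[X in X <= _]real_normK ?num_real // ler_pXn2r ?nnegrE ?nm_ge0 //.
  have -> : Re '[P (iter n S x), S (S (iter n S x))] = qform P (S (iter n S x)).
    by rewrite qform_sym.
  by rewrite ger0_norm ?qform_ge0 // qform_sym // Re_le_nm.
Qed.

(** Here the range is dense, by orthogonal projection, and closed, by the lower
    bound. *)
Lemma invertible_bounded_below T c : bounded_op T -> 0 < c ->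
  (forall x, c * nm x <= nm (T x)) ->
  (forall e, (forall x, '[e, T x] = 0) -> e = 0) -> invertible_op T.
Proof.
move=> Tbd c0 Tc Tdense; have Tlin := Tbd.1.
have [d d0 Td] := bounded_op_bound Tbd.
have T_inj x y : T x = T y -> x = y.
  move=> Txy; apply/subr0_eq/nm0_eq0; have := Tc (x - y).
  by rewrite (linB Tlin) Txy subrr nm0 pmulr_rle0.
have T_surj y : exists x, T x = y.
  have sub : linear_subspace [set v | exists w, v = T w].
    split=> [|a u v /= [u' ->] [v' ->]]; first by exists 0; rewrite (lin0 Tlin).
    by exists (a *: u' + v'); rewrite Tlin.
  have [l ladh lorth] := orthogonal_projection y sub.
  have yl : y = l.
    by apply/subr0_eq/Tdense => x; apply: lorth; exists x.
  have [u hu] : {u : nat -> H & forall n, nm (y - T (u n)) < n.+1%:R^-1}.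
    apply: (@choice _ _ (fun n w => nm (y - T w) < n.+1%:R^-1)) => n.
    have [|_ [w ->]] := ladh n.+1%:R^-1; first by rewrite invr_gt0 ltr0Sn.
    by rewrite -yl => h; exists w.
  have ucauchy n m : (n <= m)%N -> nm (u m - u n) <= 2 * n.+1%:R^-1 / c.
    move=> nm_le; rewrite ler_pdivlMr // mulrC; apply: le_trans (Tc _) _.
    have le_inv : m.+1%:R^-1 <= n.+1%:R^-1 :> R.
      by rewrite lef_pV2 ?posrE ?ltr0Sn // ler_nat.
    have := nmD (T (u m) - y) (y - T (u n)); rewrite addrA subrK.
    rewrite -(linB Tlin) (nmB _ y).
    have := hu n; have := hu m; move: le_inv.
    by move: (n.+1%:R^-1) (m.+1%:R^-1) => g h; lra.
  have small (e : R) : 0 < e -> exists n, 2 * n.+1%:R^-1 / c < e.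
    move=> e0; have [|n hn] := @invn_small R (e * c / 2).
      by rewrite divr_gt0 ?mulr_gt0.
    by exists n; rewrite ltr_pdivrMr // mulrC -ltr_pdivlMr.
  have [x hx] := modulus_cvg ucauchy small.
  exists x; apply/subr0_eq/nm0_eq0/ler_addgt0Pl => e e0; rewrite addr0.
  pose k := 2 * d / c + 1.
  have k0 : 0 < k by rewrite /k ltr_wpDl ?divr_ge0 ?mulr_ge0 // ltW.
  have [|n hn] := @invn_small R (e / k); first by rewrite divr_gt0.
  have := nmD (T (x - u n)) (T (u n) - y); rewrite (linB Tlin) addrA subrK => h.
  move: hn; rewrite ltr_pdivlMr // /k.
  have := hx n; have := hu n; have := Td (x - u n); rewrite (nmB y) (linB Tlin).
  move: h; move: (n.+1%:R^-1) => g h h1 h2 h3 h4.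
  have h5 : d * nm (x - u n) <= d * (2 * g / c) by rewrite ler_pM2l.
  lra.
have [S hS] : {S : H -> H & forall y, T (S y) = y}.
  exact: (@choice _ _ (fun y x => T x = y)).
exists S; split; last 2 first.
- by apply/funext => x; apply: T_inj; rewrite /= hS.
- by apply/funext => y /=; exact: hS.
apply: (bounded_by_op (c := c^-1)) => [a x y|y].
  by apply: T_inj; rewrite Tlin !hS.
by rewrite mulrC ler_pdivlMr // mulrC -{2}(hS y).
Qed.

Lemma bounded_sub_scale B (z : C) : bounded_op B ->
  bounded_op (fun x => B x - z *: x).
Proof.
move=> Bbd; have [b b0 Bb] := bounded_op_bound Bbd.
apply: (bounded_by_op (c := b + nm z)) => [a x y|x].
  rewrite Bbd.1.
  by apply: (@dot_eq0 _ _ H) => w; rewrite !(dotDl, dotNl, dotZl); ring.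
by apply: le_trans (nmD _ _) _; rewrite nmN nmZ; have := Bb x; lra.
Qed.

Lemma spectrum_bound B c : bounded_op B -> bounded_by B c ->
  forall z : C, spectrum B z -> nm z <= c.
Proof.
move=> Bbd Bc z Bz; rewrite leNgt; apply/negP => cz; apply: Bz.
have low x : (nm z - c) * nm x <= nm (B x - z *: x).
  have := nmD (z *: x - B x) (B x); rewrite subrK nmZ nmB.
  by have := Bc x; lra.
apply: (@invertible_bounded_below _ (nm z - c)) => //.
- exact: bounded_sub_scale.
- by rewrite subr_gt0.
move=> e /(_ e); rewrite dotBr dotZr dotxx => /eqP; rewrite subr_eq0 => /eqP he.
apply: nm0_eq0; rewrite leNgt; apply/negP => e0.
have : nm '[e, B e] <= nm e * (c * nm e).
  by apply: le_trans (Cauchy_Schwarz _ _) _; rewrite ler_wpM2l ?nm_ge0.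
rewrite he nmM nm_conj nmR ger0_norm ?sqr_ge0 //.
have -> : nm e * (c * nm e) = c * nm e ^+ 2 by ring.
by rewrite ler_pM2r ?exprn_gt0 // leNgt cz.
Qed.

Lemma spectrum_le_radius B (z : C) : bounded_op B -> spectrum B z ->
  nm z <= spectral_radius B.
Proof.
move=> Bbd Bz; have [c c0 Bc] := bounded_op_bound Bbd.
apply: ub_le_sup; last by exists z.
by exists c => _ [w Bw <-]; exact: spectrum_bound Bc _ Bw.
Qed.

Lemma spectral_radius_ge0 B : 0 <= spectral_radius B.
Proof.
have [S_sup|] := pselect (has_sup [set complex.Re `|z| | z in spectrum B]).
  have [[_ [z Bz _]] ub] := S_sup.
  by apply: le_trans (nm_ge0 z) _; apply: ub_le_sup => //; exists z.
by move=> /sup_out; rewrite /spectral_radius => ->.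
Qed.

(** An operator that is symmetric for the semi-inner product of P is bounded for
    it by its spectral radius. *)
Theorem symmetrized_le_radius P B x : bounded_op P -> positive_op P ->
  bounded_op B -> symmetrized P B ->
  qform P (B x) <= spectral_radius B ^+ 2 * qform P x.
Proof.
move=> Pbd Ppos Bbd PB; have [b b0 Bb] := bounded_op_bound Bbd.
have Blin := Bbd.1; have Plin := Pbd.1.
have Psa := positive_selfadjoint Plin Ppos.
(* The value 0 keeps E nonempty when the form of P vanishes. *)
pose E := [set e : R | e = 0 \/
  exists2 y, 0 < qform P y & e = qform P (B y) / qform P y].
have E_ub : has_ubound E.
  exists (b ^+ 2) => e [->|[y y0 ->]]; first exact: sqr_ge0.
  by rewrite ler_pdivrMr //; exact: Reid_inequality.
pose s := sup E.
have s0 : 0 <= s by apply: ub_le_sup => //; left.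
have qs y : qform P (B y) <= s * qform P y.
  have [y0|] := ltP 0 (qform P y).
    by rewrite -ler_pdivrMr //; apply: ub_le_sup => //; right; exists y.
  move=> y0; have qy : qform P y = 0 by apply/eqP; rewrite eq_le y0 qform_ge0.
  have := Reid_inequality y Pbd Ppos PB b0 Bb.
  by rewrite qy !mulr0.
suff sr : s <= spectral_radius B ^+ 2.
  by apply: le_trans (qs x) _; rewrite ler_wpM2r // qform_ge0.
rewrite leNgt; apply/negP => rs.
pose N := Num.sqrt s.
have s_gt0 : 0 < s by apply: le_lt_trans rs; exact: sqr_ge0.
have NN : N ^+ 2 = s by rewrite sqr_sqrtr.
have rN : spectral_radius B < N.
  by rewrite -(ltr_pXn2r (ltn0Sn 1)) ?nnegrE ?spectral_radius_ge0 ?sqrtr_ge0 // NN.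
have inv (z : C) : nm z = N -> invertible_op (fun y => B y - z *: y).
  move=> zN; apply: contrapT => Bz.
  by have := spectrum_le_radius Bbd Bz; rewrite zN leNgt rN.
have [|S1 [S1bd S1B BS1]] := inv (N%:C%C).
  by rewrite nmR ger0_norm ?sqrtr_ge0.
have [|S2 [S2bd S2B BS2]] := inv (- N%:C%C).
  by rewrite nmN nmR ger0_norm ?sqrtr_ge0.
(* D = B^2 - s = (B + N) (B - N) has a bounded inverse S, which is symmetrized
   by P as well. Reid's inequality for S bounds D from below for the seminorm of
   P, which improves on the constant s in qs. *)
pose D y := B (B y) - s%:C%C *: y.
have DE y : D y = (B (B y - N%:C%C *: y)) - (- N%:C%C) *: (B y - N%:C%C *: y).
  rewrite /D -NN rmorphXn (linB Blin) (linZ Blin).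
  by apply: (@dot_eq0 _ _ H) => w; rewrite !(dotDl, dotNl, dotZl); ring.
have DE' y : D y = (B (B y - (- N%:C%C) *: y)) - N%:C%C *: (B y - (- N%:C%C) *: y).
  rewrite /D -NN rmorphXn (linB Blin) (linZ Blin).
  by apply: (@dot_eq0 _ _ H) => w; rewrite !(dotDl, dotNl, dotZl); ring.
pose S := S1 \o S2.
have SD y : S (D y) = y.
  have h2 v : S2 (B v - (- N%:C%C) *: v) = v
    by exact: (congr1 (fun f => f v) S2B).
  have h1 v : S1 (B v - N%:C%C *: v) = v
    by exact: (congr1 (fun f => f v) S1B).
  by rewrite /S /= DE h2 h1.
have DS y : D (S y) = y.
  have h2 v : B (S2 v) - (- N%:C%C) *: S2 v = v
    by exact: (congr1 (fun f => f v) BS2).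
  have h1 v : B (S1 v) - N%:C%C *: S1 v = v
    by exact: (congr1 (fun f => f v) BS1).
  by rewrite DE /S /= h1 h2.
have [c1 c10 S1c] := bounded_op_bound S1bd.
have [c2 c20 S2c] := bounded_op_bound S2bd.
have Sc : bounded_by S (c1 * c2) by apply: bounded_comp => //; exact: ltW.
have c0 : 0 < c1 * c2 by exact: mulr_gt0.
move: (c1 * c2) Sc c0 => c Sc c0.
have PD : symmetrized P D.
  move=> y z; rewrite /D (linB Plin) (linZ Plin) dotBl dotBr dotZl dotZr.
  by rewrite !PB conj_real.
have PS : symmetrized P S.
  by move=> y z; rewrite -{2}(DS y) PD DS.
have key y : qform P (B y) <= (s - (c ^+ 2 * s)^-1) * qform P y.
  have := Reid_inequality (D y) Pbd Ppos PS c0 Sc; rewrite SD.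
  have -> : qform P (D y) =
      qform P (B (B y)) + s ^+ 2 * qform P y - 2 * s * qform P (B y).
    rewrite /D qformB // dotZr conj_real Re_realM PB -/(qform P (B y)).
    by rewrite {2}/qform (linZ Plin) dotZl dotZr conj_real !Re_realM /qform; ring.
  have := qs (B y); have := qform_ge0 y Ppos; have := qform_ge0 (B y) Ppos.
  move: (qform P (B (B y))) (qform P (B y)) (qform P y) => q2 q1 q0 h1 h0 h2 h.
  have cs : 0 < c ^+ 2 * s by rewrite mulr_gt0 ?exprn_gt0.
  rewrite -(ler_pM2l cs) mulrA mulrBr divff ?gt_eqF //.
  have h3 : c ^+ 2 * (q2 + s ^+ 2 * q0 - 2 * s * q1) <=
      c ^+ 2 * (s * q1 + s ^+ 2 * q0 - 2 * s * q1).
    by apply: ler_wpM2l; [exact: sqr_ge0 | lra].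
  lra.
have : s <= maxr 0 (s - (c ^+ 2 * s)^-1).
  apply: ge_sup; first by exists 0; left.
  move=> e [->|[y y0 ->]]; rewrite le_max ?lexx //; apply/orP; right.
  by rewrite ler_pdivrMr //; exact: key.
have cs : 0 < (c ^+ 2 * s)^-1 by rewrite invr_gt0 mulr_gt0 ?exprn_gt0.
by rewrite le_max leNgt s_gt0 /=; lra.
Qed.

End Symmetrizable.

(** * Berezin norms *)

Section Berezin.
Context (R : realType) (Omega : Type) (H : functional_hilbert R Omega).
Local Notation C := R[i].
Local Notation "''[' x , y ]" := (dot H x y).
Local Notation Re := (@complex.Re R).
Implicit Types (x y : H) (A B P Q T : H -> H) (c t : R).
Hypothesis kernel_neq0 : forall l : Omega, kernel H l != 0.

Lemma nm_nkernel l : nm (nkernel H l) = 1.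
Proof.
have k0 : `|kernel H l| != 0 by rewrite normr_eq0.
apply: complexI; rewrite -normE /nkernel normrZ normfV normr_id mulVf //.
Qed.

Lemma qform_le_ber T l : bounded_op T -> qform T (nkernel H l) <= ber T.
Proof.
move=> Tbd; have [c c0 Tc] := bounded_op_bound Tbd.
apply: le_trans (Re_le_nm _) _; apply: ub_le_sup; last by exists (l, l).
exists c => _ [[m n] _ <-] /=; rewrite -/(nm _).
apply: le_trans (Cauchy_Schwarz _ _) _; rewrite nm_nkernel mulr1.
by apply: le_trans (Tc _) _; rewrite nm_nkernel mulr1.
Qed.

Lemma add_op_bounded P Q : bounded_op P -> bounded_op Q ->
  bounded_op (add_op P Q).
Proof.
move=> Pbd Qbd; have [p p0 Pp] := bounded_op_bound Pbd.
have [q q0 Qq] := bounded_op_bound Qbd.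
apply: (bounded_by_op (c := p + q)) => [a x y|x].
  by rewrite /add_op Pbd.1 Qbd.1 scalerDr addrACA.
by apply: le_trans (nmD _ _) _; have := Pp x; have := Qq x; lra.
Qed.

Lemma scale_op_bounded t P : bounded_op P -> bounded_op (scale_op t P).
Proof.
move=> Pbd; have [p p0 Pp] := bounded_op_bound Pbd.
apply: (bounded_by_op (c := `|t| * p)) => [a x y|x].
  by rewrite /scale_op Pbd.1 scalerDr !scalerA mulrC.
by rewrite /scale_op nmZ nmR -mulrA ler_wpM2l.
Qed.

Lemma qform_add P Q x : qform (add_op P Q) x = qform P x + qform Q x.
Proof. by rewrite /qform /add_op dotDl ReD. Qed.

Lemma qform_scale t P x : qform (scale_op t P) x = t * qform P x.
Proof. by rewrite /qform /scale_op dotZl Re_realM. Qed.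

(** The Cauchy-Schwarz inequality for the weights t and 1 - t. *)
Lemma weighted_sqrt_le t (a b a' b' : R) : 0 <= t -> t <= 1 ->
  0 <= a -> 0 <= b -> 0 <= a' -> 0 <= b' ->
  t * Num.sqrt (a * b') + (1 - t) * Num.sqrt (a' * b) <=
  Num.sqrt ((t * a + (1 - t) * b) * (t * b' + (1 - t) * a')).
Proof.
move=> t0 t1 a0 b0 a0' b0'; rewrite (sqrtrM b') // (sqrtrM b) //.
have t1' : 0 <= 1 - t by rewrite subr_ge0.
have e (z : R) : 0 <= z -> exists2 w, 0 <= w & z = w ^+ 2.
  by move=> z0; exists (Num.sqrt z); rewrite ?sqrtr_ge0 ?sqr_sqrtr.
have [u u0 ->] := e a a0; have [v v0 ->] := e b b0.
have [u' u0' ->] := e a' a0'; have [v' v0' ->] := e b' b0'.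
rewrite !sqrtr_sqr !ger0_norm //.
have l0 : 0 <= t * (u * v') + (1 - t) * (u' * v).
  by rewrite addr_ge0 ?mulr_ge0.
rewrite -[X in X <= _](ger0_norm l0) -sqrtr_sqr; apply: ler_wsqrtr.
have : 0 <= t * (1 - t) * (u * u' - v * v') ^+ 2.
  by rewrite mulr_ge0 ?sqr_ge0 ?mulr_ge0.
lra.
Qed.

(** The pointwise form of the theorem: the mixed Schwarz inequality at B x,
    followed by the bound of B for the seminorm of |A|. *)
Theorem dot_le_radius A B x y : bounded_op A -> bounded_op B ->
  abs_op A \o B = adjoint B \o abs_op A ->
  nm '[A (B x), y] <= spectral_radius B *
    Num.sqrt (qform (abs_op A) x * qform (abs_op (adjoint A)) y).
Proof.
move=> Abd Bbd AB; have [A'bd _] := adjoint_exists Abd.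
have [Pbd Ppos _ _] := abs_opP Abd; have [_ Qpos _ _] := abs_opP A'bd.
have PB : symmetrized (abs_op A) B.
  by move=> u v; rewrite -dot_adjoint // -[abs_op A (B u)]/((abs_op A \o B) u) AB.
have r0 := spectral_radius_ge0 B.
have pos : 0 <= qform (abs_op A) x * qform (abs_op (adjoint A)) y.
  by rewrite mulr_ge0 ?qform_ge0.
rewrite -(ler_pXn2r (ltn0Sn 1)) ?nnegrE ?nm_ge0 ?mulr_ge0 ?sqrtr_ge0 //.
rewrite exprMn sqr_sqrtr // mulrA; apply: le_trans (mixed_Schwarz _ _ Abd) _.
by rewrite ler_wpM2r ?qform_ge0 //; exact: symmetrized_le_radius.
Qed.

Theorem weighted_dot_le_radius A B t x y : 0 <= t -> t <= 1 ->
  bounded_op A -> bounded_op B ->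
  abs_op A \o B = adjoint B \o abs_op A ->
  t * nm '[A (B x), y] + (1 - t) * nm '[adjoint (A \o B) x, y] <=
  spectral_radius B *
    Num.sqrt ((t * qform (abs_op A) x + (1 - t) * qform (abs_op (adjoint A)) x) *
              (t * qform (abs_op (adjoint A)) y + (1 - t) * qform (abs_op A) y)).
Proof.
move=> t0 t1 Abd Bbd AB; have [A'bd _] := adjoint_exists Abd.
have [_ Ppos _ _] := abs_opP Abd; have [_ Qpos _ _] := abs_opP A'bd.
have ABbd : bounded_op (A \o B).
  have [a a0 Aa] := bounded_op_bound Abd; have [b b0 Bb] := bounded_op_bound Bbd.
  apply: (bounded_by_op (c := a * b)).
    by apply: linear_comp; [case: Abd | case: Bbd].
  by apply: bounded_comp => //; exact: ltW.
have t1' : 0 <= 1 - t by rewrite subr_ge0.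
rewrite dot_adjoint // [nm '[x, _]]nm_dotC.
have h1 := ler_wpM2l t0 (dot_le_radius x y Abd Bbd AB).
have h2 := ler_wpM2l t1' (dot_le_radius y x Abd Bbd AB).
apply: le_trans (lerD h1 h2) _.
rewrite mulrCA [X in _ + X]mulrCA -mulrDr.
apply: ler_wpM2l; first exact: spectral_radius_ge0.
by apply: weighted_sqrt_le => //; exact: qform_ge0.
Qed.

Lemma tber_le (M : R) t T : [set: Omega] !=set0 ->
  (forall l m, t * nm '[T (nkernel H l), nkernel H m]
     + (1 - t) * nm '[adjoint T (nkernel H l), nkernel H m] <= M) ->
  tber t T <= M.
Proof.
move=> [o _] h; apply: ge_sup; first by eexists; exists (o, o).
by move=> _ [[l m] _ <-]; exact: h.
Qed.

End Berezin.

Theorem theorem2p4 (R : realType) (Omega : Type)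
    (Omega_neq0 : [set: Omega] !=set0) (H : functional_hilbert R Omega)
    (kernel_neq0 : forall l : Omega, kernel H l != 0)
    (t : R) (t_ge0 : 0 <= t) (t_le1 : t <= 1)
    (A B : {linear H -> H}) (A_cont : continuous A) (B_cont : continuous B)
    (AB : abs_op A \o B = adjoint B \o abs_op A) :
  (tber t (A \o B) <=
     spectral_radius B *
     Num.sqrt (ber (add_op (scale_op t (abs_op A))
                           (scale_op (1 - t) (abs_op (adjoint A)))) *
               ber (add_op (scale_op t (abs_op (adjoint A)))
                           (scale_op (1 - t) (abs_op A)))))
  /\
  (tber (1 / 2) (A \o B) <=
     1 / 2 * spectral_radius B *
     ber (add_op (abs_op A) (abs_op (adjoint A)))).
Proof.
have Abd : bounded_op A by split=> //; exact: linearP.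
have Bbd : bounded_op B by split=> //; exact: linearP.
have [A'bd _] := adjoint_exists Abd.
have [Pbd Ppos _ _] := abs_opP Abd; have [Qbd Qpos _ _] := abs_opP A'bd.
have t1' : 0 <= 1 - t by rewrite subr_ge0.
split; apply: tber_le => // l m.
  apply: le_trans (weighted_dot_le_radius _ _ t_ge0 t_le1 Abd Bbd AB) _.
  apply: ler_wpM2l; first exact: spectral_radius_ge0.
  apply: ler_wsqrtr; apply: ler_pM.
  - by rewrite addr_ge0 ?mulr_ge0 ?qform_ge0.
  - by rewrite addr_ge0 ?mulr_ge0 ?qform_ge0.
  - rewrite -!qform_scale -qform_add; apply: qform_le_ber => //.
    by apply: add_op_bounded; exact: scale_op_bounded.
  - rewrite -!qform_scale -qform_add; apply: qform_le_ber => //.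
    by apply: add_op_bounded; exact: scale_op_bounded.
have h0 : 0 <= 1 / 2 :> R by lra.
have h1 : 1 / 2 <= 1 :> R by lra.
apply: le_trans (weighted_dot_le_radius _ _ h0 h1 Abd Bbd AB) _.
set b := ber _.
have -> : 1 / 2 * spectral_radius B * b = spectral_radius B * (1 / 2 * b) by ring.
apply: ler_wpM2l; first exact: spectral_radius_ge0.
have le_b n : qform (abs_op A) (nkernel H n)
    + qform (abs_op (adjoint A)) (nkernel H n) <= b.
  by rewrite -qform_add; apply: qform_le_ber => //; exact: add_op_bounded.
have q0 n := qform_ge0 (nkernel H n) Ppos.
have q0' n := qform_ge0 (nkernel H n) Qpos.
have b0 : 0 <= 1 / 2 * b.
  by have := le_b l; have := q0 l; have := q0' l; lra.
rewrite -[X in _ <= X](ger0_norm b0) -sqrtr_sqr; apply: ler_wsqrtr.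
rewrite expr2; have := le_b l; have := le_b m.
have := q0 l; have := q0' l; have := q0 m; have := q0' m.
by move=> *; apply: ler_pM; lra.
Qed.
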